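(* Let $m\in\mathbb Z\setminus\{0\}$ and $\xi\in\mathbb Z_m$. Define elements of the free group $\mathbb F(a,b)$ by $b_1=ab^ma^{-1}$ and $b_i=ab_{i-1}b^{-r_{i-1}(\xi)}a^{-1}$ for $i\ge2$. Then the marked group $\overline{BS}(m,\xi)$ admits the presentation $$\overline{BS}(m,\xi)=\langle a,b\mid [b,b_i]=1,\ i\ge1\rangle.$$ In particular $\overline{BS}(m,0)=\langle a,b\mid [b,a^ib^ma^{-i}]=1,\ i\ge1\rangle$, and this latter presentation is minimal: for every $k\ge1$, the relation $[b,a^kb^ma^{-k}]=1$ does not hold in the group $\langle a,b\mid [b,a^ib^ma^{-i}]=1,\ i\ge1,\ i\ne k\rangle$.
   Context: For $p,q\in\mathbb Z\setminus\{0\}$, $BS(p,q)=\langle a,b\mid ab^pa^{-1}=b^q\rangle$, marked by $(a,b)$. The space of marked groups on two generators $\mathcal G_2$ is the set of normal subgroups of the free group $\mathbb F(a,b)$, with the ultrametric $d(N_1,N_2)=e^{-\lambda}$ ($N_1\ne N_2$), $\lambda$ the minimal word length of an element of $N_1\triangle N_2$. $\mathbb Z_m=\varprojlim\mathbb Z/m^h\mathbb Z$ is the ring of $m$-adic integers. For $\xi\in\mathbb Z_m$, $\overline{BS}(m,\xi)$ denotes the limit in $\mathcal G_2$ of $BS(m,\xi_n)$ for any sequence of integers $(\xi_n)$ with $|\xi_n|\to\infty$ and $\xi_n\to\xi$ in $\mathbb Z_m$ (this limit exists and is independent of the sequence), marked by the images of $a,b$. The functions $r_i$: $r_0(\xi)=0$,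 $s_0(\xi)=1$, and for $i\ge1$, $r_i(\xi)\in\{0,\dots,|m|-1\}$, $s_i(\xi)\in\mathbb Z_m$ are the unique elements with $\xi s_{i-1}(\xi)=m s_i(\xi)+r_i(\xi)$. Note $r_i(0)=0$ for all $i$. *)

(* Defs.v *)
(* Free group F(a,b) as words up to free reduction;
   marked groups as normal subgroups (sets of words closed under free equivalence). *)
From HB Require Import structures.
From mathcomp Require Import all_boot all_order all_algebra.
Set Implicit Arguments. Unset Strict Implicit. Unset Printing Implicit Defensive.
Import Order.TTheory GRing.Theory Num.Theory.
Local Open Scope ring_scope.

Inductive gen := Ga | Gb.

(* a letter is a generator together with a flag: true = inverse *)
Definition letter := (gen * bool)%type.
Definition word := seq letter.

Definition linv (x : letter) : letter := (x.1, ~~ x.2).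
Definition winv (w : word) : word := rev (map linv w).

Definition wa : word := [:: (Ga, false)].
Definition wb : word := [:: (Gb, false)].

Inductive fequiv : word -> word -> Prop :=
| fe_refl w : fequiv w w
| fe_red u v x : fequiv (u ++ [:: x; linv x] ++ v) (u ++ v)
| fe_sym w w' : fequiv w w' -> fequiv w' w
| fe_trans w1 w2 w3 : fequiv w1 w2 -> fequiv w2 w3 -> fequiv w1 w3.

(* normal closure in F(a,b) of a set R of relators: words representing a
   product of conjugates of relators and their inverses.  This is the
   kernel of F(a,b) -> < a, b | R >, i.e. the marked group < a, b | R >. *)
Inductive nclos (R : word -> Prop) : word -> Prop :=
| nc_nil : nclos R [::]
| nc_conj g r w : R r -> nclos R w -> nclos R (g ++ r ++ winv g ++ w)
| nc_conjinv g r w : R r -> nclos R w -> nclos R (g ++ winv r ++ winv g ++ w)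
| nc_equiv w w' : nclos R w -> fequiv w w' -> nclos R w'.

Definition wpown (w : word) (n : nat) : word := flatten (nseq n w).
Definition wpow (w : word) (z : int) : word :=
  match z with Posz n => wpown w n | Negz n => wpown (winv w) n.+1 end.

Definition wcomm (x y : word) : word := x ++ y ++ winv x ++ winv y.

Definition BS_rel (p q : int) : word -> Prop :=
  fun r => r = wa ++ wpow wb p ++ winv wa ++ winv (wpow wb q).
Definition BS (p q : int) : word -> Prop := nclos (BS_rel p q).

(* ---------- Space of marked groups: convergence ----------
   d(N1,N2) = e^{-lambda}, lambda = minimal length of an element of N1 /_\ N2.
   N_n -> N  iff  for every L, eventually N_n and N agree on all elements of
   length <= L.  Since our sets are closed under free equivalence, quantifying
   over all words of size <= L is the same as over reduced words. *)
Definition mconv (Ns : nat -> word -> Prop) (N : word -> Prop) : Prop :=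
  forall L : nat, exists n0 : nat, forall n : nat, (n0 <= n)%N ->
    forall w : word, (size w <= L)%N -> (Ns n w <-> N w).

(* ---------- m-adic integers ----------
   An element of Z_m = lim Z/|m|^h Z is given by a sequence x : nat -> int of
   compatible representatives: x h represents the class modulo |m|^h. *)
Definition is_madic (m : int) (x : nat -> int) : Prop :=
  forall h : nat, (x h.+1 = x h %[mod `|m| ^+ h])%Z.

Definition madic_conv (m : int) (xs : nat -> int) (xi : nat -> int) : Prop :=
  forall h : nat, exists n0 : nat, forall n : nat, (n0 <= n)%N ->
    (xs n = xi h %[mod `|m| ^+ h])%Z.

Definition tends_infty (xs : nat -> int) : Prop :=
  forall B : int, exists n0 : nat, forall n : nat, (n0 <= n)%N -> B < `|xs n|.

(* s_i and r_i : s_0 = 1, r_0 = 0, and xi s_{i-1} = m s_i + r_i with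
   0 <= r_i < |m|.  Computed on representatives:
   r_i = (xi s_{i-1} mod |m|), and s_i at level h is
   ((xi s_{i-1} - r_i) at level h+1) divided (exactly) by m. *)
Fixpoint sr (m : int) (xi : nat -> int) (i : nat) : (nat -> int) * int :=
  match i with
  | 0 => (fun _ => 1, 0)
  | i'.+1 =>
      let s := (sr m xi i').1 in
      let r := ((xi 1%N * s 1%N) %% `|m|)%Z in
      (fun h => ((xi h.+1 * s h.+1 - r) %/ m)%Z, r)
  end.
Definition r_ (m : int) (xi : nat -> int) (i : nat) : int := (sr m xi i).2.

Fixpoint bw (m : int) (xi : nat -> int) (i : nat) : word :=
  match i with
  | 0 => [::]
  | 1 => wa ++ wpow wb m ++ winv wa
  | (i'.+1) as j => wa ++ bw m xi i' ++ wpow wb (- r_ m xi i') ++ winv wa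
  end.

Definition BSbar_rel (m : int) (xi : nat -> int) : word -> Prop :=
  fun r => exists i : nat, (1 <= i)%N /\ r = wcomm wb (bw m xi i).

(* relators [b, a^i b^m a^-i], i >= 1, i != k (k = 0 : no exclusion) *)
Definition BS0_rel_except (m : int) (k : nat) : word -> Prop :=
  fun r => exists i : nat, [/\ (1 <= i)%N, i != k &
    r = wcomm wb (wpown wa i ++ wpow wb m ++ winv (wpown wa i))].

(* Main.v *)
(** Conjugating by [a] turns [b^m, b_1 b^(-r_1), b_2 b^(-r_2), ...] into
[b_1, b_2, b_3, ...], so the relations [[b, b_i] = 1] already make all the [b_i]
commute with each other. The words [b_0^(p_0) b_1^(p_1) ...], with [b_0 = b], are
therefore handled as polynomials [p] over [Z], and conjugation by [a] sends a
sublattice [theta (Z[X])] onto [X Z[X]]. In BS(m, N) one has [b_i = b^(N s_(i-1)(N))],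
which identifies [p] with a power of [b] and gives the relations for [N] close to [xi].

Conversely, in the presented group each word reduces to a product of polynomials
and letters [a^(+-1)] without pinches. For large [|N|] with [N] close to [xi], this
product has no pinch in BS(m, N) either: [m | p_0 + sum p_i r_i] is the
same condition as divisibility by [m] of the exponent in BS(m, N), while [N] divides
this exponent only if [p_0 = 0]. By Britton's lemma the word is then nontrivial in
BS(m, N), unless no letter [a] remains and [p = 0]. Britton's lemma for BS(p, q) comes
from the action on normal forms.

For minimality, in a restricted wreath product of a group [H] with [Z] send [a] to the
shift and [b] to the function with value [x] at [0], [y] at [-k] and [1] elsewhere. Then
[a^i b^m a^-i] commutes with [b] for all [i >= 1] except [i = k], provided [x] and [y^m]
do not commute in [H]. *)
Require Import Defs.
From HB Require Import structures.
From mathcomp Require Import all_boot all_order all_algebra.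
From mathcomp Require Import zify ring.
From Corelib Require Import Setoid Morphisms.
Import Order.TTheory GRing.Theory Num.Theory.

Set Implicit Arguments. Unset Strict Implicit. Unset Printing Implicit Defensive.

(** * Equality of words modulo a set of relators *)

Section Words.
Local Open Scope ring_scope.
Implicit Types (R S : word -> Prop) (u v w g : word).

Lemma linvK : involutive linv.
Proof. by case=> x e; rewrite /linv /= negbK. Qed.

Lemma winv_cat u v : winv (u ++ v) = winv v ++ winv u.
Proof. by rewrite /winv map_cat rev_cat. Qed.

Lemma winvK : involutive winv.
Proof. by move=> w; rewrite /winv map_rev revK mapK //; exact: linvK. Qed.

Lemma fequiv_ctx x y u v : fequiv u v -> fequiv (x ++ u ++ y) (x ++ v ++ y).
Proof.
elim=> {u v} [w|u v l|u v _ IH|u v w _ IHu _ IHv].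
- exact: fe_refl.
- rewrite -!catA (catA x u) (catA x u); exact: fe_red.
- exact: fe_sym.
- exact: fe_trans IHu IHv.
Qed.

Lemma fequiv_cancel u w v : fequiv (u ++ w ++ winv w ++ v) (u ++ v).
Proof.
elim/last_ind: w v => [|w l IH] v; first exact: fe_refl.
rewrite -cats1 winv_cat -!catA; apply: fe_trans (IH v).
rewrite (catA u w) (catA u w _); exact: (@fe_red (u ++ w) (winv w ++ v) l).
Qed.

Lemma fequiv_cancelV u w v : fequiv (u ++ winv w ++ w ++ v) (u ++ v).
Proof. by have := fequiv_cancel u (winv w) v; rewrite winvK. Qed.

Lemma nclos_cat R u v : nclos R u -> nclos R v -> nclos R (u ++ v).
Proof.
move=> Hu Hv; elim: Hu => {u} [|g r w Hr _ IH|g r w Hr _ IH|w w' _ IH E] //.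
- by rewrite -!catA; apply: nc_conj.
- by rewrite -!catA; apply: nc_conjinv.
- by apply: nc_equiv IH _; apply: (fequiv_ctx [::] v).
Qed.

Lemma nclos_conj R g w : nclos R w -> nclos R (g ++ w ++ winv g).
Proof.
elim=> {w} [|h r w Hr _ IH|h r w Hr _ IH|w w' _ IH E].
- apply: nc_equiv (nc_nil R) _; apply: fe_sym.
  by have := fequiv_cancel [::] g [::]; rewrite !cats0.
- apply: nc_equiv (nc_conj (g ++ h) Hr IH) _.
  rewrite winv_cat -!catA.
  by have := fequiv_cancelV (g ++ h ++ r ++ winv h) g (w ++ winv g); rewrite -!catA.
- apply: nc_equiv (nc_conjinv (g ++ h) Hr IH) _.
  rewrite winv_cat -!catA.
  by have := fequiv_cancelV (g ++ h ++ winv r ++ winv h) g (w ++ winv g); rewrite -!catA.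
- by apply: nc_equiv IH _; apply: fequiv_ctx.
Qed.

Lemma nclos_rel R r : R r -> nclos R r.
Proof. by move=> Hr; have := nc_conj [::] Hr (nc_nil R); rewrite !cats0. Qed.

Lemma fequiv_winv u v : fequiv u v -> fequiv (winv u) (winv v).
Proof.
elim=> {u v} [w|u v l|u v _ IH|u v w _ IHu _ IHv].
- exact: fe_refl.
- rewrite !winv_cat -!catA.
  have -> : winv [:: l; linv l] = [:: l; linv l] by rewrite /winv /= /rev /= linvK.
  exact: fe_red.
- exact: fe_sym.
- exact: fe_trans IHu IHv.
Qed.

Lemma nclos_winv R w : nclos R w -> nclos R (winv w).
Proof.
elim=> {w} [|g r w Hr _ IH|g r w Hr _ IH|w w' _ IH E].
- exact: nc_nil.
- rewrite !winv_cat winvK -!catA; apply: nclos_cat IH _.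
  by have := nc_conjinv g Hr (nc_nil R); rewrite !cats0.
- rewrite !winv_cat !winvK -!catA; apply: nclos_cat IH _.
  by have := nc_conj g Hr (nc_nil R); rewrite !cats0.
- by apply: nc_equiv IH _; apply: fequiv_winv.
Qed.

Lemma nclos_sub R S w :
  (forall r, R r -> nclos S r) -> nclos R w -> nclos S w.
Proof.
move=> RS; elim=> {w} [|g r w Hr _ IH|g r w Hr _ IH|w w' _ IH E].
- exact: nc_nil.
- by rewrite !catA; apply: nclos_cat IH; rewrite -catA; apply/nclos_conj/RS.
- by rewrite !catA; apply: nclos_cat IH; rewrite -catA; apply/nclos_conj/nclos_winv/RS.
- exact: nc_equiv IH E.
Qed.

Definition weq R u v := nclos R (u ++ winv v).

Lemma weq_nil R w : weq R w [::] <-> nclos R w.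
Proof. by rewrite /weq cats0. Qed.

Lemma fequiv_weq R u v : fequiv u v -> weq R u v.
Proof.
move=> E; apply: nc_equiv (nc_nil R) _; apply: fe_sym.
apply: (fe_trans (w2 := v ++ winv v)); first exact: (fequiv_ctx [::]).
by have := fequiv_cancel [::] v [::]; rewrite !cats0.
Qed.

#[global] Instance weq_equiv R : Equivalence (weq R).
Proof.
split=> [u|u v|u v w].
- exact/fequiv_weq/fe_refl.
- by rewrite /weq => /nclos_winv; rewrite winv_cat winvK.
- rewrite /weq => Huv Hvw; apply: nc_equiv (nclos_cat Huv Hvw) _.
  by rewrite -catA; apply: fequiv_cancelV.
Qed.

Lemma weq_refl R u : weq R u u.
Proof. exact: reflexivity. Qed.
#[local] Hint Resolve weq_refl : core.

Lemma weq_cat R u u' v v' :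
  weq R u u' -> weq R v v' -> weq R (u ++ v) (u' ++ v').
Proof.
move=> Hu Hv; rewrite /weq winv_cat.
apply: nc_equiv (nclos_cat (nclos_conj u Hv) Hu) _; rewrite -!catA.
by have := fequiv_cancelV (u ++ v ++ winv v') u (winv u'); rewrite -!catA.
Qed.

#[global] Instance weq_cat_proper R :
  Proper (weq R ==> weq R ==> weq R) (@cat letter).
Proof. by move=> u u' Hu v v' Hv; apply: weq_cat. Qed.

Lemma weq_mulV R u v : weq R (u ++ winv u ++ v) v.
Proof. exact/fequiv_weq/(fequiv_cancel [::]). Qed.

Lemma weq_Vmul R u v : weq R (winv u ++ u ++ v) v.
Proof. exact/fequiv_weq/(fequiv_cancelV [::]). Qed.

Lemma weq_mulV1 R u : weq R (u ++ winv u) [::].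
Proof. by have := weq_mulV R u [::]; rewrite !cats0. Qed.

Lemma weq_Vmul1 R u : weq R (winv u ++ u) [::].
Proof. by have := weq_Vmul R u [::]; rewrite !cats0. Qed.

Lemma weq_cancel R x u v : weq R (x ++ u) (x ++ v) -> weq R u v.
Proof. by move=> H; rewrite -(weq_Vmul R x u) H weq_Vmul. Qed.

Lemma wpowS R w z : weq R (wpow w (z + 1)) (w ++ wpow w z).
Proof.
case: z => [n|[|n]].
- by rewrite addrC.
- by rewrite /= /wpown /= cats0 weq_mulV1.
- have -> : Negz n.+1 + 1 = Negz n by rewrite !NegzE; lia.
  by rewrite /= /wpown /= weq_mulV.
Qed.

(** Integer powers are the only solution of this recursion; the power laws below follow without case
    analysis on the sign of the exponent. *)
Lemma wpow_uniq R w (f : int -> word) :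
  weq R (f 0) [::] -> (forall z, weq R (f (z + 1)) (w ++ f z)) ->
  forall z, weq R (f z) (wpow w z).
Proof.
move=> f0 fS; elim/int_ind => [|n IH|n IH].
- by rewrite f0.
- by rewrite -addn1 PoszD fS IH wpowS.
- apply: (@weq_cancel R w); rewrite -fS -wpowS.
  by have -> : - (n.+1%:Z) + 1 = - n%:Z by lia.
Qed.

Lemma wpow1 w : wpow w 1 = w.
Proof. by rewrite /= /wpown /= cats0. Qed.

Lemma wpow_com R w z : weq R (w ++ wpow w z) (wpow w z ++ w).
Proof.
apply: (@weq_cancel R (winv w)); rewrite weq_Vmul; symmetry.
apply: (@wpow_uniq R w (fun z => winv w ++ wpow w z ++ w)) => [|y].
  by rewrite weq_Vmul1.
by rewrite wpowS -catA weq_Vmul weq_mulV.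
Qed.

Lemma wpowD R w x y : weq R (wpow w (x + y)) (wpow w x ++ wpow w y).
Proof.
apply: (@weq_cancel R (winv (wpow w x))); rewrite weq_Vmul.
apply: (@wpow_uniq R w (fun y => winv (wpow w x) ++ wpow w (x + y))) => [|z].
  by rewrite addr0 weq_Vmul1.
apply: (@weq_cancel R (wpow w x)); rewrite weq_mulV addrA wpowS.
by rewrite catA -wpow_com -catA weq_mulV.
Qed.

Lemma wpow_weq R u v z : weq R u v -> weq R (wpow u z) (wpow v z).
Proof. move=> E; apply: (@wpow_uniq R v (wpow u)) => [//|y].
by rewrite wpowS; apply: weq_cat. Qed.

Lemma wpowM R w x y : weq R (wpow w (x * y)) (wpow (wpow w x) y).
Proof.
apply: (@wpow_uniq R (wpow w x) (fun y => wpow w (x * y))) => [|{}y].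
  by rewrite mulr0.
by rewrite mulrDr mulr1 addrC wpowD.
Qed.

Lemma wpow_conj R g w z :
  weq R (g ++ wpow w z ++ winv g) (wpow (g ++ w ++ winv g) z).
Proof.
apply: (@wpow_uniq R _ (fun z => g ++ wpow w z ++ winv g)) => [|y].
  by rewrite weq_mulV1.
by rewrite wpowS -!catA weq_Vmul.
Qed.

Definition wcom R u v := weq R (u ++ v) (v ++ u).

Lemma wcom_sym R u v : wcom R u v -> wcom R v u.
Proof. by rewrite /wcom => H; symmetry. Qed.

Lemma wcom_refl R u : wcom R u u.
Proof. by rewrite /wcom. Qed.

Lemma wcom_cat R u v w : wcom R u v -> wcom R u w -> wcom R u (v ++ w).
Proof. by rewrite /wcom => Hv Hw; rewrite catA Hv -!catA Hw. Qed.

Lemma wcom_winv R u v : wcom R u v -> wcom R u (winv v).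
Proof.
rewrite /wcom => H; apply: (@weq_cancel R v).
by rewrite weq_mulV catA -H -catA weq_mulV1 cats0.
Qed.

Lemma wcom_wpow R u v z : wcom R u v -> wcom R u (wpow v z).
Proof.
rewrite /wcom => H; apply: (@weq_cancel R (winv u)); rewrite weq_Vmul.
symmetry; apply: (@wpow_uniq R v (fun z => winv u ++ wpow v z ++ u)) => [|y].
  by rewrite weq_Vmul1.
rewrite wpowS -!catA; have := wcom_winv (wcom_sym H).
rewrite /wcom => E; by rewrite (catA (winv u) v) -E -catA.
Qed.

Lemma wcom_conj R g u v : wcom R u v ->
  wcom R (g ++ u ++ winv g) (g ++ v ++ winv g).
Proof. by rewrite /wcom => H; rewrite -!catA !weq_Vmul !(catA u) !(catA v) H. Qed.

Lemma wpow_cat R u v z : wcom R u v ->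
  weq R (wpow (u ++ v) z) (wpow u z ++ wpow v z).
Proof.
move=> H; symmetry.
apply: (@wpow_uniq R _ (fun z => wpow u z ++ wpow v z)) => [//|y].
have := wcom_wpow y (wcom_sym H).
rewrite /wcom => E; by rewrite !wpowS -!catA !(catA (wpow u y)) -E -!catA.
Qed.

Lemma wcommP R u v : nclos R (wcomm u v) <-> wcom R u v.
Proof. by rewrite /wcom /weq /wcomm winv_cat -!catA; split. Qed.

End Words.

#[local] Hint Resolve weq_refl : core.

(** * Actions of the free group and of its quotients *)

Section Actions.
Local Open Scope ring_scope.
Implicit Types (R : word -> Prop) (u v w g : word).

Definition act (T : Type) (f : letter -> T -> T) w (t : T) : T := foldr f t w.

Lemma act_cat T f u v (t : T) : act f (u ++ v) t = act f u (act f v t).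
Proof. exact: foldr_cat. Qed.

(** Letters have to be invertible only on the stable subset [V], such as the valid normal forms. *)
Definition is_action (T : Type) (V : T -> Prop) (f : letter -> T -> T) : Prop :=
  forall l t, V t -> V (f l t) /\ f l (f (linv l) t) = t.

Lemma act_stable T V f w (t : T) : is_action V f -> V t -> V (act f w t).
Proof. by move=> Hf Vt; elim: w => //= l w IH; case: (Hf l _ IH). Qed.

Lemma fequiv_act T V f u v (t : T) :
  is_action V f -> fequiv u v -> V t -> act f u t = act f v t.
Proof.
move=> Hf E; elim: E t => {u v} [w|u v l|u v _ IH|u v w _ IHu _ IHv] t Vt //.
- rewrite !act_cat /=; congr act.
  by have [_ ->] := Hf l _ (act_stable v Hf Vt).
- by rewrite IH.
- by rewrite IHu // IHv.
Qed.

Lemma act_Vmul T V f w (t : T) : is_action V f -> V t -> act f (winv w) (act f w t) = t.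
Proof.
move=> Hf Vt; rewrite -act_cat.
by apply: (@fequiv_act _ V f _ [::]) => //; have := fequiv_cancelV [::] w [::]; rewrite !cats0.
Qed.

Lemma act_mulV T V f w (t : T) : is_action V f -> V t -> act f w (act f (winv w) t) = t.
Proof. by have := @act_Vmul T V f (winv w) t; rewrite winvK. Qed.

(** Nontriviality is proved with this: a word that moves a point of [V] is outside the normal
    closure. *)
Lemma nclos_act T V f R w (t : T) : is_action V f ->
  (forall r t, R r -> V t -> act f r t = t) ->
  nclos R w -> V t -> act f w t = t.
Proof.
move=> Hf HR Hw; elim: Hw t => {w} [|g r w Hr _ IH|g r w Hr _ IH|u v _ IH E] t Vt //.
- have Vg := act_stable (winv g) Hf Vt.
  by rewrite !act_cat IH // (HR _ _ Hr Vg) (act_mulV g Hf Vt).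
- have Vg := act_stable (winv g) Hf Vt.
  rewrite !act_cat IH // -[in LHS](HR r _ Hr Vg) (act_Vmul _ Hf Vg).
  exact: (act_mulV g Hf Vt).
- by rewrite -(fequiv_act Hf E) ?IH.
Qed.

Lemma act_wpown T f w n (t : T) : act f (wpown w n) t = iter n (act f w) t.
Proof. by elim: n => //= n IH; rewrite /wpown /= act_cat -IH. Qed.

End Actions.

(** * Minimality of the presentation for xi = 0 *)

Section Minimality.
Local Open Scope ring_scope.

(* The wreath product acting fibrewise on [int * (int * int)], where [H] is generated by
   [x : (u, v) |-> (u + v, v)] and [y : (u, v) |-> (u, v + 1)] acting on [int * int]. *)
Definition fibact (k : int) (l : letter) (t : int * (int * int)) : int * (int * int) :=
  let: (n, (u, v)) := t in
  let e : int := if l.2 then -1 else 1 in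
  match l.1 with
  | Ga => (n + e, (u, v))
  | Gb => if n == 0 then (n, (u + e * v, v))
          else if n == - k then (n, (u, v + e)) else t
  end.

Lemma fibact_action k : is_action (fun _ => True) (fibact k).
Proof.
move=> [[] e] [n [u v]] _; split=> //; rewrite /fibact /=.
  by case: e; rewrite ?addrK ?subrK.
case n0: (n == 0); first by rewrite n0; case: e => /=; congr (_, (_, _)); ring.
case nk: (n == - k); rewrite n0 nk //.
by case: e => /=; congr (_, (_, _)); ring.
Qed.

Lemma fibact_a k i n s : act (fibact k) (wpown wa i) (n, s) = (n + i%:Z, s).
Proof.
case: s => u v; rewrite act_wpown; elim: i => [|i IH] /=; first by rewrite addr0.
by rewrite IH /=; congr (_, _); lia.
Qed.

Lemma fibact_aV k i n s : act (fibact k) (winv (wpown wa i)) (n, s) = (n - i%:Z, s).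
Proof.
have := act_Vmul (wpown wa i) (fibact_action k) (t := (n - i%:Z, s)) I.
by rewrite fibact_a subrK.
Qed.

Lemma fibact_bpow k z n u v :
  act (fibact k) (wpow wb z) (n, (u, v)) =
  if n == 0 then (n, (u + z * v, v))
  else if n == - k then (n, (u, v + z)) else (n, (u, v)).
Proof.
have H (e : bool) (i : nat) : act (fibact k) (wpown [:: (Gb, e)] i) (n, (u, v)) =
    let z := (if e then -1 else 1) * i%:Z in
  if n == 0 then (n, (u + z * v, v))
  else if n == - k then (n, (u, v + z)) else (n, (u, v)).
  rewrite act_wpown; elim: i => [|i IH] /=.
    by rewrite mulr0 mul0r !addr0 !if_same.
  rewrite /= in IH; rewrite IH /=.
  case: (eqVneq n 0) => [->|n0] /=; first by congr (_, (_, _)); case: (e); ring.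
  case: (eqVneq n (- k)) => [n1|nk] /=; last by rewrite (negbTE n0) (negbTE nk).
  by rewrite (negbTE n0) n1 eqxx; congr (_, (_, _)); case: (e); ring.
case: z => i; first by have /= -> := H false i; rewrite mul1r.
by have /= -> := H true i.+1; rewrite mulN1r NegzE.
Qed.

Lemma act_wcomm T V f u v (t : T) : is_action V f -> V t ->
  act f (wcomm u v) (act f (v ++ u) t) = act f (u ++ v) t.
Proof.
move=> Hf Vt; rewrite /wcomm -winv_cat catA act_cat.
by rewrite (act_Vmul _ Hf Vt).
Qed.

Lemma BS0_minimal (m : int) (k : nat) : m != 0 -> (1 <= k)%N ->
  ~ nclos (BS0_rel_except m k)
      (wcomm wb (wpown wa k ++ wpow wb m ++ winv (wpown wa k))).
Proof.
move=> m0 k0; pose f := fibact k; have Hf := fibact_action k.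
pose c i := wpown wa i ++ wpow wb m ++ winv (wpown wa i).
have cE i n u v : act f (c i) (n, (u, v)) =
    if n == i%:Z then (n, (u + m * v, v))
    else if n == i%:Z - k%:Z then (n, (u, v + m)) else (n, (u, v)).
  rewrite !act_cat fibact_aV fibact_bpow subr_eq0.
  case: eqP => _; first by rewrite fibact_a subrK.
  have -> : (n - i%:Z == - k%:Z) = (n == i%:Z - k%:Z) by lia.
  by case: eqP => _; rewrite fibact_a subrK.
have bE n u v : act f wb (n, (u, v)) =
    if n == 0 then (n, (u + v, v))
    else if n == - k%:Z then (n, (u, v + 1)) else (n, (u, v)).
  by rewrite -[wb]wpow1 fibact_bpow mul1r.
have R1 r t : BS0_rel_except m k r -> True -> act f r t = t.
  case=> i [i1 ik ->] _.
  have E s : act f (wb ++ c i) s = act f (c i ++ wb) s.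
    case: s => n [u v]; rewrite (act_cat f wb) (act_cat f (c i)).
    (* [b] moves only the fibres [0] and [-k], [c i] only [i] and [i - k]; these are disjoint as
       [i >= 1] and [i != k]. *)
    case A: (n == 0); case B: (n == - k%:Z); case C: (n == i%:Z);
      case D: (n == i%:Z - k%:Z); try (exfalso; lia);
      by do 4 (rewrite ?(cE, bE, A, B, C, D); cbv match).
  have := act_wcomm wb (c i) (t := act f (winv (c i ++ wb)) t) Hf I.
  by rewrite E (act_mulV _ Hf).
(* For [i = k] the fibre 0 is shared: from [(0, 0)], applying [c k] and then [b] gives [u = m], the
   other order gives [u = 0]. *)
have := act_wcomm wb (c k) (t := (0, (0, 0))) Hf I.
move=> + Hk; rewrite (nclos_act Hf R1 Hk) // (act_cat f wb) (act_cat f (c k)).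
have A : (0 == k%:Z) = false by lia.
rewrite bE !(cE, bE, A, eqxx, subrr); cbv match.
by rewrite !add0r => -[/esym/eqP]; rewrite (negbTE m0).
Qed.
End Minimality.

(** * Normal forms and Britton's lemma for BS(p, q) *)

Section Britton.
Local Open Scope ring_scope.

(* [Cons e r t] stands for [b^r a^(+-1) t], with [e = true] for [a^-1]. *)
Inductive nf := Last of int | Cons of bool & int & nf.

(* With the sign convention of [nf], [b^(edge e) a^e = a^e b^(edge (~~ e))],
   since [a b^p = b^q a] in BS(p,q). *)
Definition edge (p q : int) (e : bool) : int := if e then p else q.

(** Left multiplication by [b^j]: the remainder stays before the letter, the quotient crosses it as
    a multiple of [edge p q (~~ e)]. *)
Fixpoint mulb p q (j : int) (t : nf) : nf :=
  match t with
  | Last z => Last (j + z)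
  | Cons e r t' => Cons e ((j + r) %% edge p q e)%Z
      (mulb p q (((j + r) %/ edge p q e)%Z * edge p q (~~ e)) t')
  end.

Definition cancels (e : bool) (t : nf) : bool :=
  if t is Cons e' r _ then (r == 0) && (e' != e) else false.

Definition mula (e : bool) (t : nf) : nf :=
  if t is Cons e' r t' then
    if (r == 0) && (e' != e) then t' else Cons e 0 t
  else Cons e 0 t.

Fixpoint valid p q (t : nf) : Prop :=
  match t with
  | Last _ => True
  | Cons e r t' => [/\ (r %% edge p q e)%Z = r, ~~ cancels e t' & valid p q t']
  end.

Lemma edge_neq0 p q e : p != 0 -> q != 0 -> edge p q e != 0.
Proof. by case: e. Qed.

Lemma mulbD p q i j t : p != 0 -> q != 0 ->
  mulb p q i (mulb p q j t) = mulb p q (i + j) t.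
Proof.
move=> p0 q0; elim: t i j => [z|e r t IH] i j /=; first by rewrite addrA.
rewrite IH modzDmr addrA -mulrDl; congr (Cons _ _ (mulb _ _ (_ * _) _)).
set d := edge p q e; have d0 : d != 0 by exact: edge_neq0.
have -> : i + j + r = ((j + r) %/ d)%Z * d + (i + ((j + r) %% d)%Z).
  by rewrite addrCA -divz_eq addrA.
by rewrite divzMDl // addrC.
Qed.

Lemma mulb0 p q t : valid p q t -> mulb p q 0 t = t.
Proof.
elim: t => [z|e r t IH] /=; first by rewrite add0r.
case=> Hr _ Ht; rewrite add0r Hr.
suff -> : ((r %/ edge p q e)%Z * edge p q (~~ e)) = 0 by rewrite IH.
(* If [edge p q e] is 0, division by it gives 0, so nothing is carried past the letter. *)
have [->|d0] := eqVneq (edge p q e) 0; first by rewrite divz0 mul0r.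
by rewrite -Hr divz_small ?mul0r // modz_ge0 // ltz_mod.
Qed.

(** A power of [b] carried past [a^e] creates no cancellation: a next letter of the same sign never
    cancels, and one of opposite sign has modulus [edge p q (~~ e)], so its residue is unchanged. *)
Lemma cancels_mulb p q e z t : valid p q t ->
  cancels e (mulb p q (z * edge p q (~~ e)) t) = cancels e t.
Proof.
case: t => [|e' r t] //= [Hr _ _].
have [//|/negbTE e'e] := eqVneq e' e; first by rewrite !andbF.
have -> : ~~ e = e' by case: (e) (e') e'e => [] [].
by rewrite modzMDl Hr.
Qed.

Lemma valid_mulb p q z t : valid p q t -> valid p q (mulb p q z t).
Proof.
elim: t z => [//|e r t IH] z /= [Hr Ht Vt]; split; last exact: IH.
  by rewrite modz_mod.
by rewrite cancels_mulb.
Qed.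

Lemma mula_push e t : ~~ cancels e t -> mula e t = Cons e 0 t.
Proof. by case: t => //= e' r t /negbTE ->. Qed.

Lemma valid_mula p q e t : valid p q t -> valid p q (mula e t).
Proof.
move=> Vt; have [C|C] := boolP (cancels e t); last first.
  by rewrite mula_push //=; split=> //; rewrite mod0z.
by case: t C Vt => //= e' r t -> [].
Qed.

(** If the first letter is cancelled, validity keeps the rest from cancelling again, so the letter
    is put back. *)
Lemma mulaK p q e t : valid p q t -> mula e (mula (~~ e) t) = t.
Proof.
move=> Vt; have [C|C] := boolP (cancels (~~ e) t); last first.
  by rewrite (mula_push C); case: (e).
case: t C Vt => //= e' r t C [_ Ct _]; rewrite C.
case/andP: C => /eqP -> e'e.
have E : e' = e by case: (e) (e') e'e => [] [].
by rewrite mula_push -?E.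
Qed.

Lemma mula_mulb p q t : p != 0 -> q != 0 -> valid p q t ->
  mula false (mulb p q p (mula true t)) = mulb p q q t.
Proof.
move=> p0 q0 Vt; have [C|C] := boolP (cancels true t).
  case: t C Vt => //= e r t C [_ Ct Vt]; rewrite C.
  case/andP: C => /eqP -> /negPf; case: e Ct => //= Ct _.
  rewrite addr0 modzz divzz q0 mul1r mula_push //.
  by have := cancels_mulb false 1 Vt; rewrite mul1r => ->.
by rewrite (mula_push C) /= addr0 modzz divzz p0 mul1r.
Qed.

Definition nfact p q (l : letter) (t : nf) : nf :=
  match l.1 with
  | Ga => mula l.2 t
  | Gb => mulb p q (if l.2 then -1 else 1) t
  end.

Lemma nfact_action p q : p != 0 -> q != 0 -> is_action (valid p q) (nfact p q).
Proof.
move=> p0 q0 [[] e] t Vt; rewrite /nfact /=; split.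
- exact: valid_mula.
- exact: mulaK Vt.
- exact: valid_mulb.
- by rewrite mulbD //; case: e => /=; rewrite ?addrN ?addNr mulb0.
Qed.

Lemma nfact_bpow p q z t : p != 0 -> q != 0 -> valid p q t ->
  act (nfact p q) (wpow wb z) t = mulb p q z t.
Proof.
move=> p0 q0 Vt.
have H (e : bool) (i : nat) : act (nfact p q) (wpown [:: (Gb, e)] i) t =
    mulb p q ((if e then -1 else 1) * i%:Z) t.
  rewrite act_wpown; elim: i => [|i IH] /=; first by rewrite mulr0 mulb0.
  rewrite /= in IH; rewrite IH /nfact /= mulbD //; congr mulb.
  by case: (e); lia.
case: z => i; first by have /= -> := H false i; rewrite mul1r.
by have /= -> := H true i.+1; rewrite mulN1r NegzE.
Qed.

Lemma BS_nfact p q w t : p != 0 -> q != 0 -> BS p q w -> valid p q t ->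
  act (nfact p q) w t = t.
Proof.
move=> p0 q0; have Hf := nfact_action p0 q0.
apply: (nclos_act Hf) => {w} _ {}t -> Vt.
have Vb := act_stable (winv (wpow wb q)) Hf Vt.
rewrite !act_cat -[winv wa]/[:: (Ga, true)] nfact_bpow //; last exact: valid_mula.
rewrite [LHS]mula_mulb // -nfact_bpow //; exact: (act_mulV _ Hf Vt).
Qed.

(** Generic in [T] to cover both integer exponents in BS(m, N) and polynomials in the presented
    group. *)
Fixpoint sform (T : Type) (f : T -> word) (x : T) (s : seq (bool * T)) : word :=
  f x ++ (if s is (e, y) :: s' then (Ga, e) :: sform f y s' else [::]).

(* [pinch e y] is to mean that [a^e y a^-e] can be simplified. *)
Fixpoint reduced (T : Type) (pinch : bool -> T -> bool) (s : seq (bool * T)) : Prop :=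
  match s with
  | (e, y) :: s' =>
      (forall e' y' s'', s' = (e', y') :: s'' -> e' = ~~ e -> ~ pinch e y) /\
      reduced pinch s'
  | [::] => True
  end.

(** Under this divisibility [b^z] can cross [a^e] to its left, after which [a^e] meets [a^-e]. *)
Definition zpinch p q (e : bool) (z : int) : bool := (edge p q (~~ e) %| z)%Z.

(** The normal form keeps the leading letter of a reduced word: a cancellation would make the
    residue of [y] modulo [edge p q (~~ e)] zero, which is a pinch. *)
Lemma act_sform p q x e y s : p != 0 -> q != 0 ->
  reduced (zpinch p q) ((e, y) :: s) ->
  exists t, act (nfact p q) (sform (wpow wb) x ((e, y) :: s)) (Last 0) =
            Cons e (x %% edge p q e)%Z t.
Proof.
move=> p0 q0; have Hf := nfact_action p0 q0.
elim: s x e y => [|[e' y'] s IH] x e y.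
  move=> _; rewrite /= cats0 act_cat /= -/(act _ _ _).
  rewrite (nfact_bpow y p0 q0 (t := Last 0)) //.
  by rewrite nfact_bpow /nfact //= ?addr0; [eexists | split=> //; rewrite mod0z].
case=> /(_ _ _ _ erefl) Hey /IH - /(_ y) [t]; rewrite [sform _ x _]/= act_cat => E.
set w := sform _ y _ in E *.
have V : valid p q (act (nfact p q) w (Last 0)).
  by apply: (act_stable w Hf).
have C : ~~ cancels e (act (nfact p q) w (Last 0)).
  rewrite E /=; apply/negP => /andP[/eqP H /negP e'e].
  have {e'e} e'E : e' = ~~ e by case: (e) (e') e'e => [] [].
  by apply: (Hey e'E); apply/dvdz_mod0P; rewrite -e'E.
rewrite nfact_bpow //; last exact: valid_mula.
rewrite -[_ :: _]/((Ga, e) :: w) [act _ _ _]/= -/(act _ _ _) /nfact mula_push //=.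
by rewrite addr0; eexists.
Qed.

(** The word is applied to [Last 0]: a remaining letter gives a [Cons], and without letters the
    result is [Last x]. *)
Lemma britton p q x s : p != 0 -> q != 0 ->
  reduced (zpinch p q) s -> (s = [::] -> x != 0) ->
  ~ BS p q (sform (wpow wb) x s).
Proof.
move=> p0 q0 Hs Hx /(BS_nfact p0 q0) - /(_ (Last 0) I).
case: s Hs Hx => [|[e y] s] Hs Hx.
  by rewrite /= cats0 nfact_bpow //= addr0 => -[/eqP]; rewrite (negPf (Hx _)).
by have [t ->] := act_sform x p0 q0 Hs.
Qed.
End Britton.

(** * Linear forms on integer polynomials *)

Section LinearForms.
Local Open Scope ring_scope.
Implicit Types (f g : nat -> int) (p q : {poly int}).

Definition lin f p : int := \sum_(i < size p) p`_i * f i.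

Lemma lin_widen f p n : (size p <= n)%N -> lin f p = \sum_(i < n) p`_i * f i.
Proof.
move=> le_pn; rewrite /lin (big_ord_widen _ (fun i => p`_i * f i) le_pn) big_mkcond.
apply: eq_bigr => i _; case: ltnP => // le_pi.
by rewrite (nth_default _ le_pi) mul0r.
Qed.

Lemma linD f p q : lin f (p + q) = lin f p + lin f q.
Proof.
have Hp := leq_maxl (size p) (size q); have Hq := leq_maxr (size p) (size q).
rewrite (lin_widen f Hp) (lin_widen f Hq) (lin_widen f (size_polyD p q)).
by rewrite -big_split; apply: eq_bigr => i _; rewrite coefD mulrDl.
Qed.

Lemma linC f c : lin f c%:P = c * f 0%N.
Proof. by rewrite (lin_widen f (size_polyC_leq1 c)) big_ord1 coefC. Qed.

Lemma linZXn f c i : lin f (c *: 'X^i) = c * f i.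
Proof.
have H : (size (c *: 'X^i)%R <= i.+1)%N.
  by apply: leq_trans (size_scale_leq _ _) _; rewrite size_polyXn.
rewrite (lin_widen f H) (bigD1 ord_max) //= coefZ coefXn eqxx mulr1.
rewrite big1 ?addr0 // => j; rewrite -val_eqE /= => /negbTE nj.
by rewrite coefZ coefXn nj mulr0 mul0r.
Qed.

Lemma linXM f p : lin f ('X * p) = lin (f \o S) p.
Proof.
have H : (size ('X * p)%R <= (size p).+1)%N.
  by apply: leq_trans (size_polyMleq _ _) _; rewrite size_polyX.
rewrite (lin_widen f H) big_ord_recl coefXM mul0r add0r.
by apply: eq_bigr => i _; rewrite coefXM.
Qed.

(** Lets additive statements be checked on monomials; the empty sum is a monomial with coefficient
    0. *)
Lemma poly_span (P : {poly int} -> Prop) :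
  (forall c i, P (c *: 'X^i)) -> (forall p q, P p -> P q -> P (p + q)) ->
  forall p, P p.
Proof.
move=> PX PD p; rewrite -[p]coefK poly_def.
elim/big_ind: _ => //; by have := PX 0 0%N; rewrite scale0r.
Qed.
End LinearForms.

(** * The commuting elements b_i and symbolic forms in the presented group *)

Section Abelian.
Local Open Scope ring_scope.
Implicit Types (m : int) (xi : nat -> int) (p q : {poly int}) (i j : nat).

(** [bw] is empty at index 0, where [b_0 = b] is wanted. *)
Definition bgen m xi i : word := if i is 0 then wb else bw m xi i.

Definition cgen m xi i : word :=
  if i is 0 then wpow wb m else bw m xi i ++ wpow wb (- r_ m xi i).

Lemma bgenS m xi i : bgen m xi i.+1 = wa ++ cgen m xi i ++ winv wa.
Proof. by case: i => [|i] //; rewrite /bgen /cgen [LHS]/= -!catA. Qed.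

(** By induction: [b_(i+1)] and [b_(j+1)] are conjugates by [a] of [cgen] at [i] and [j], which are
    words in [b, b_i] and in [b, b_j]. Index 0 is given by the relators. *)
Lemma bgen_com m xi i j : wcom (BSbar_rel m xi) (bgen m xi i) (bgen m xi j).
Proof.
set R := BSbar_rel m xi.
have B0 k : wcom R wb (bgen m xi k).
  case: k => [|k]; first exact: wcom_refl.
  by apply/wcommP/nclos_rel; exists k.+1.
elim: i j => [|i IH] j; first exact: B0.
have Hc l w : wcom R wb w -> wcom R (bgen m xi l) w -> wcom R (cgen m xi l) w.
  case: l => [|l] H0 H1; first exact/wcom_sym/wcom_wpow/wcom_sym.
  by apply/wcom_sym/wcom_cat; [|apply: wcom_wpow]; exact: wcom_sym.
have C k : wcom R (bgen m xi i) (bgen m xi k) -> wcom R (cgen m xi i) (cgen m xi k).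
  move=> H; apply: (Hc i); apply: wcom_sym; apply: (Hc k).
  - exact: wcom_refl.
  - exact/wcom_sym/B0.
  - exact: B0.
  - exact: wcom_sym.
case: j => [|j]; first exact/wcom_sym/B0.
by rewrite !bgenS; apply/wcom_conj/C/IH.
Qed.

(* The word [b_0^(p_0) b_1^(p_1) ...], with [b_0 = b]: polynomials are vectors
   with integer coordinates. *)
Definition vwn m xi n p : word :=
  flatten [seq wpow (bgen m xi i) p`_i | i <- iota 0 n].
Definition vw m xi p : word := vwn m xi (size p) p.

Lemma vwnS m xi n p : vwn m xi n.+1 p = vwn m xi n p ++ wpow (bgen m xi n) p`_n.
Proof. by rewrite /vwn -addn1 iotaD map_cat flatten_cat /= cats0. Qed.

Lemma vwn_vw m xi n p : (size p <= n)%N -> vwn m xi n p = vw m xi p.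
Proof.
elim: n => [|n IH]; first by rewrite leqn0 => /eqP E; rewrite /vw E.
rewrite leq_eqVlt => /orP[/eqP E|]; first by rewrite /vw E.
rewrite ltnS => H; rewrite vwnS IH // (nth_default _ H).
by rewrite /= /wpown /= cats0.
Qed.

Lemma wcom_vwn m xi w n p :
  (forall i, wcom (BSbar_rel m xi) w (bgen m xi i)) ->
  wcom (BSbar_rel m xi) w (vwn m xi n p).
Proof.
move=> H; elim: n => [|n IH]; first by rewrite /wcom cats0.
by rewrite vwnS; apply: wcom_cat IH _; apply: wcom_wpow.
Qed.

Lemma vwD m xi p q :
  weq (BSbar_rel m xi) (vw m xi (p + q)) (vw m xi p ++ vw m xi q).
Proof.
set R := BSbar_rel m xi.
have H n : weq R (vwn m xi n (p + q)) (vwn m xi n p ++ vwn m xi n q).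
  elim: n => [//|n IH]; rewrite !vwnS coefD wpowD IH.
  have : wcom R (wpow (bgen m xi n) p`_n) (vwn m xi n q).
    apply: wcom_vwn => i; apply/wcom_sym/wcom_wpow; exact: bgen_com.
  by rewrite /wcom -!catA => E; rewrite (catA (wpow _ _) (vwn _ _ _ _)) E -!catA.
have := H (maxn (size p) (size q)).
rewrite !vwn_vw //; [exact: leq_maxr|exact: leq_maxl|exact: size_polyD].
Qed.

Lemma vw0 m xi : vw m xi 0 = [::].
Proof. by rewrite /vw size_poly0. Qed.

Lemma vwZXn m xi c i :
  weq (BSbar_rel m xi) (vw m xi (c *: 'X^i)) (wpow (bgen m xi i) c).
Proof.
have H : (size (c *: 'X^i)%R <= i.+1)%N.
  by apply: leq_trans (size_scale_leq _ _) _; rewrite size_polyXn.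
rewrite -(vwn_vw m xi H) vwnS coefZ coefXn eqxx mulr1.
suff -> : vwn m xi i (c *: 'X^i) = [::] by [].
have : forall j, (j <= i)%N -> vwn m xi j (c *: 'X^i) = [::]; last exact.
elim=> [//|j IH] lt_ji; rewrite vwnS IH 1?ltnW //.
by rewrite coefZ coefXn (ltn_eqF lt_ji) mulr0.
Qed.

Lemma vwC m xi c : weq (BSbar_rel m xi) (vw m xi c%:P) (wpow wb c).
Proof. by rewrite -(vwn_vw m xi (size_polyC_leq1 c)) vwnS coefC. Qed.

(** Modulo the elements [cgen], [b_i] equals [b^(rho i)]; hence the value 1 at index 0, where
    [r_0 = 0]. *)
Definition rho m xi i : int := if i is 0 then 1 else r_ m xi i.

(* Conjugation by [a] maps [theta p] to ['X * p]. *)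
Definition theta m xi p : {poly int} := p + (m * p`_0 - lin (rho m xi) p)%:P.

Lemma thetaD m xi p q : theta m xi (p + q) = theta m xi p + theta m xi q.
Proof.
rewrite /theta linD coefD addrACA -polyCD; congr (_ + _%:P); ring.
Qed.


(** These are the coordinates of the power [c] of [cgen m xi i], which determines the formula of
    [theta]. *)
Lemma thetaZXn m xi c i :
  theta m xi (c *: 'X^i) =
  if i is 0 then (m * c)%:P else c *: 'X^i + (- (c * r_ m xi i))%:P.
Proof.
rewrite /theta linZXn coefZ coefXn; case: i => [|i] /=.
  rewrite !mulr1 expr0 alg_polyC -polyCD; congr _%:P; ring.
by rewrite !mulr0 add0r.
Qed.

Lemma vw_conj m xi p :
  weq (BSbar_rel m xi) (wa ++ vw m xi (theta m xi p) ++ winv wa) (vw m xi ('X * p)).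
Proof.
move: p; apply: poly_span => [c i|p q Hp Hq]; last first.
  by rewrite thetaD mulrDr (vwD _ _ (theta m xi p)) (vwD _ _ ('X * p)) -Hp -Hq -!catA weq_Vmul.
rewrite -scalerAr -exprS vwZXn bgenS -wpow_conj thetaZXn.
suff -> : weq (BSbar_rel m xi)
  (vw m xi (if i is 0 then (m * c)%:P else c *: 'X^i + (- (c * r_ m xi i))%:P))
  (wpow (cgen m xi i) c) by [].
case: i => [|i]; first by rewrite vwC wpowM.
rewrite vwD vwC vwZXn wpow_cat.
  rewrite -wpowM mulNr (mulrC c); exact: weq_refl.
by apply: wcom_wpow; apply: (bgen_com m xi i.+1 0).
Qed.

Lemma vw_conjV m xi p :
  weq (BSbar_rel m xi) (winv wa ++ vw m xi ('X * p) ++ wa) (vw m xi (theta m xi p)).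
Proof. by rewrite -vw_conj -!catA weq_Vmul weq_Vmul1 cats0. Qed.

(* The positions where a symbolic form can be simplified in the limit group. *)
Definition ppinch m xi (e : bool) p : bool :=
  if e then p`_0 == 0 else (m %| lin (rho m xi) p)%Z.

Lemma dvdXP p : p`_0 = 0 -> exists q, p = 'X * q.
Proof.
move=> p0; exists (\poly_(i < size p) p`_i.+1); apply/polyP => i.
rewrite coefXM coef_poly; case: i => [|i] //=; case: ltnP => // H.
by rewrite nth_default // ltnW.
Qed.

Lemma thetaP m xi p : (m %| lin (rho m xi) p)%Z -> exists q, p = theta m xi q.
Proof.
(* [theta] alters only the constant term, and the [rho] form of [theta q] is [m q_0]; so [q] is [p]
   with constant term [c]. *)
case/dvdzP => c Hc; exists (p + (c - p`_0)%:P).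
rewrite /theta linD linC coefD coefC eqxx Hc -addrA -polyCD.
by rewrite -[LHS]addr0 -(polyC0 int); congr (_ + _%:P); ring.
Qed.

Lemma ppinchP m xi e p : ppinch m xi e p -> exists q,
  weq (BSbar_rel m xi) ([:: (Ga, e)] ++ vw m xi p ++ [:: (Ga, ~~ e)]) (vw m xi q).
Proof.
case: e => [/eqP/dvdXP [q ->]|/(@thetaP m xi) [q ->]].
  exists (theta m xi q); exact: vw_conjV.
by exists ('X * q); exact: vw_conj.
Qed.

Lemma vw_sformD m xi p q s :
  weq (BSbar_rel m xi) (sform (vw m xi) (p + q) s) (vw m xi p ++ sform (vw m xi) q s).
Proof. by case: s => [|[e r] s] /=; rewrite vwD -catA. Qed.

(** Letters are multiplied on the left: [b] changes only the leading polynomial, on which [reduced]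
    puts no condition; [a^(+-1)] pinches with the first letter of [s] or is put before it. *)
Lemma symbolic_form m xi w : exists p s, reduced (ppinch m xi) s /\
  weq (BSbar_rel m xi) w (sform (vw m xi) p s).
Proof.
set R := BSbar_rel m xi.
elim: w => [|[x e] w [p [s [Hs E]]]].
  by exists 0, [::]; rewrite /= vw0.
have {}E : weq R ((x, e) :: w) ([:: (x, e)] ++ sform (vw m xi) p s).
  by rewrite -E.
case: x E => E; last first.
  exists ((if e then -1 else 1)%:P + p), s; split=> //.
  by rewrite E vw_sformD vwC; case: (e).
have [C|C] := boolP (if s is (e', _) :: _ then (e' == ~~ e) && ppinch m xi e p else false).
  case: s C Hs E => [//|[e' p'] s] /andP[/eqP -> Hp] [_ Hs] E.
  have [q Hq] := ppinchP Hp.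
  exists (q + p'), s; split=> //; rewrite E vw_sformD -Hq -!catA.
  exact: weq_refl.
exists 0, ((e, p) :: s); split; last by rewrite E /= vw0.
split=> // e' p' s' Es Ee; move: C; rewrite Es Ee eqxx /=.
by move/negP.
Qed.

End Abelian.

(** * Properties that hold for all large n *)

Section Eventually.
Implicit Types (P Q : nat -> Prop).

Definition ev P : Prop := exists n0, forall n, (n0 <= n)%N -> P n.

Lemma ev_mono P Q : (forall n, P n -> Q n) -> ev P -> ev Q.
Proof. by move=> PQ [n0 H]; exists n0 => n /H /PQ. Qed.

Lemma ev_and P Q : ev P -> ev Q -> ev (fun n => P n /\ Q n).
Proof.
move=> [n0 H0] [n1 H1]; exists (maxn n0 n1) => n; rewrite geq_max.
by case/andP=> /H0 ? /H1.
Qed.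

Lemma ev_true P : (forall n, P n) -> ev P.
Proof. by move=> H; exists 0. Qed.

Lemma ev_absurd P : ev P -> ev (fun n => ~ P n) -> False.
Proof. by move=> H /(ev_and H) [n0 /(_ _ (leqnn n0)) []]. Qed.

Lemma ev_all (P : nat -> nat -> Prop) k :
  (forall i, ev (P i)) -> ev (fun n => forall i, (i < k)%N -> P i n).
Proof.
move=> H; elim: k => [|k IH]; first exact: ev_true.
apply: ev_mono (ev_and IH (H k)) => n [Hk Hn] i.
by rewrite ltnS leq_eqVlt => /predU1P [-> //|]; exact: Hk.
Qed.

(** Only finitely many words have bounded length, so convergence of marked groups can be tested on
    one word at a time. *)
Lemma ev_words (P : word -> nat -> Prop) L : (forall w, ev (P w)) ->
  ev (fun n => forall w, (size w <= L)%N -> P w n).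
Proof.
elim: L P => [|L IH] P H.
  by apply: ev_mono (H [::]) => n Hn w; rewrite leqn0 => /nilP ->.
have Hl l := IH (fun w => P (l :: w)) (fun w => H (l :: w)).
have := ev_and (ev_and (Hl (Ga, true)) (Hl (Ga, false)))
               (ev_and (Hl (Gb, true)) (Hl (Gb, false))).
move/(ev_and (H [::])); apply: ev_mono => n [H0 [[H1 H2] [H3 H4]]].
case=> [//|[[] []] w] /= Hw; [exact: H1|exact: H2|exact: H3|exact: H4].
Qed.

End Eventually.

(** * Comparison with BS(m, N) for N close to xi, and the limit *)

Section Limit.
Local Open Scope ring_scope.
Implicit Types (m N : int) (xi xs : nat -> int) (p q : {poly int}).

(* The integers [s_i(N)], computed with the residues [r_i(xi)]; the divisions are
   exact as long as [N] is close to [xi] in [Z_m]. *)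
Fixpoint sint m xi N (i : nat) : int :=
  if i is j.+1 then ((N * sint m xi N j - r_ m xi i) %/ m)%Z else 1.

Definition sexact m xi N (k : nat) : Prop := forall i, (i < k)%N ->
  N * sint m xi N i = m * sint m xi N i.+1 + r_ m xi i.+1.

Lemma sintS m xi N i :
  sint m xi N i.+1 = ((N * sint m xi N i - r_ m xi i.+1) %/ m)%Z.
Proof. by []. Qed.

Lemma eqz_modP (d x y : int) : (x = y %[mod d])%Z <-> (d %| x - y)%Z.
Proof. by rewrite -eqz_mod_dvd; split=> [->|/eqP]. Qed.

(** Subtracting the same residue from [N s_i(N)] and [xi s_i(xi)] and dividing by [m] loses one
    level of precision, so the [s_i] agree modulo [|m|^h] for [h + i <= k]. *)
Lemma sint_exact m xi N k : m != 0 ->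
  (forall h, (h <= k)%N -> (N = xi h %[mod `|m| ^+ h])%Z) -> sexact m xi N k.
Proof.
move=> m0 HN.
have dvdm (x : int) : (`|m|%R %| x)%Z = (m %| x)%Z by rewrite !dvdzE; congr (dvdn _ _); lia.
have step i : (forall h, (h + i <= k)%N ->
    (sint m xi N i = (sr m xi i).1 h %[mod `|m| ^+ h])%Z) ->
  forall h, (h.+1 + i <= k)%N ->
   (`|m| ^+ h.+1 %| (N * sint m xi N i - r_ m xi i.+1)
      - (xi h.+1 * (sr m xi i).1 h.+1 - r_ m xi i.+1))%Z.
  move=> IH h hk; set y := xi h.+1 * _.
  have -> z r : z - r - (y - r) = z - y by ring.
  apply/eqz_modP; rewrite /y.
  rewrite -modzMml HN ?modzMml; last by apply: leq_trans hk; exact: leq_addr.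
  by rewrite -modzMmr IH // modzMmr.
have pdvd h (x : int) : (`|m|%R ^+ h.+1 %| x)%Z -> (m %| x)%Z.
  by rewrite -dvdm exprS; apply: dvdz_trans; exact: dvdz_mulr.
have exact_div i : (forall h, (h + i <= k)%N ->
    (sint m xi N i = (sr m xi i).1 h %[mod `|m| ^+ h])%Z) -> (i < k)%N ->
    (m %| N * sint m xi N i - r_ m xi i.+1)%Z.
  (* Modulo [m] level 1 suffices, and there [r_ m xi i.+1] is by definition the residue of
     [xi s_i]. *)
  move=> IH ik; rewrite -[X in (_ %| X)%Z](subrK (xi 1%N * (sr m xi i).1 1%N - r_ m xi i.+1)).
  apply: rpredD; first exact: (pdvd 0%N _ (step i IH 0%N ik)).
  rewrite -dvdm /r_ /=; set y := _ * _; set d := (X in (y %% X)%Z).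
  rewrite [X in X - _](divz_eq y d) addrK; exact: dvdz_mull.
have mulK (x : int) : (m %| x)%Z -> x = m * (x %/ m)%Z.
  by move=> /divzK {1}<-; rewrite mulrC.
have cong i : forall h, (h + i <= k)%N ->
    (sint m xi N i = (sr m xi i).1 h %[mod `|m| ^+ h])%Z.
  elim: i => [//|i IH] h; rewrite addnS -addSn => hk.
  have ik : (i < k)%N by apply: leq_trans hk; rewrite addSn ltnS leq_addl.
  have HA := exact_div i IH ik; have HAB := step i IH h hk.
  have HB : (m %| xi h.+1 * (sr m xi i).1 h.+1 - r_ m xi i.+1)%Z.
    by have := pdvd _ _ HAB; rewrite (rpredBl _ HA).
  apply/eqz_modP; move: HAB; rewrite (mulK _ HA) (mulK _ HB) -mulrBr.
  rewrite exprS !dvdzE !abszM (_ : absz (Num.norm m) = absz m); last by lia.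
  by rewrite dvdn_pmul2l ?absz_gt0.
by move=> i ik; rewrite sintS -mulK ?subrK //; apply: exact_div ik; exact: cong.
Qed.

Lemma ev_sexact m xi xs k : m != 0 -> madic_conv m xs xi ->
  ev (fun n => sexact m xi (xs n) k).
Proof.
move=> m0 H; apply: ev_mono (ev_all k.+1 H) => n Hn.
exact: sint_exact.
Qed.

Definition tau m xi N (i : nat) : int := if i is j.+1 then N * sint m xi N j else 1.

Lemma BS_conj m N z : weq (BS_rel m N) (wa ++ wpow wb (m * z) ++ winv wa) (wpow wb (N * z)).
Proof.
rewrite wpowM wpow_conj (wpowM _ _ N z); apply: wpow_weq.
by apply: nclos_rel; rewrite /BS_rel -!catA.
Qed.

(** Exactness turns [cgen] into [b^(m s_i)], which [a] conjugates to [b^(N s_i)]. *)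
Lemma BS_bgen m xi N k i : sexact m xi N k -> (i <= k)%N ->
  weq (BS_rel m N) (bgen m xi i) (wpow wb (tau m xi N i)).
Proof.
move=> HN; elim: i => [|i IH] ik; first by rewrite wpow1.
rewrite bgenS -BS_conj.
suff -> : weq (BS_rel m N) (cgen m xi i) (wpow wb (m * sint m xi N i)) by [].
case: i IH ik => [|i] IH ik; first by rewrite mulr1.
have -> : cgen m xi i.+1 = bgen m xi i.+1 ++ wpow wb (- r_ m xi i.+1) by [].
rewrite IH; last exact: ltnW.
by rewrite -wpowD [tau _ _ _ _]/= (HN i (ltnW ik)) addrK.
Qed.

(** Each [[b, b_i]] holds once [b_i] is a power of [b], and a derivation of [w] uses finitely many
    relators. *)
Lemma ev_BS m xi xs w : m != 0 -> madic_conv m xs xi ->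
  nclos (BSbar_rel m xi) w -> ev (fun n => BS m (xs n) w).
Proof.
move=> m0 Hxs.
have Hrel r : BSbar_rel m xi r -> ev (fun n => BS m (xs n) r).
  case=> i [/prednK <- ->]; move: (i.-1) => {}i; apply: ev_mono (ev_sexact i.+1 m0 Hxs) => n Hn.
  have E := BS_bgen Hn (leqnn i.+1).
  apply/wcommP; rewrite -/(bgen m xi i.+1) /wcom E.
  exact/wcom_wpow/wcom_refl.
elim=> {w} [|g r w /Hrel Hr _ IH|g r w /Hrel Hr _ IH|w w' _ IH E].
- by apply: ev_true => n; exact: nc_nil.
- apply: ev_mono (ev_and Hr IH) => n [H1 H2].
  by rewrite !catA; apply: nclos_cat H2; rewrite -catA; apply: nclos_conj.
- apply: ev_mono (ev_and Hr IH) => n [H1 H2].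
  by rewrite !catA; apply: nclos_cat H2; rewrite -catA; apply/nclos_conj/nclos_winv.
- by apply: ev_mono IH => n H; apply: nc_equiv E.
Qed.

Lemma BS_vw m xi N k p : sexact m xi N k -> (size p <= k)%N ->
  weq (BS_rel m N) (vw m xi p) (wpow wb (lin (tau m xi N) p)).
Proof.
move=> HN pk.
suff H n : (n <= size p)%N -> weq (BS_rel m N) (vwn m xi n p)
    (wpow wb (\sum_(i < n) p`_i * tau m xi N i)) by exact: H.
elim: n => [|n IH] np; first by rewrite big_ord0.
rewrite vwnS big_ord_recr wpowD IH 1?ltnW //= (mulrC p`_n) wpowM.
suff -> : weq (BS_rel m N) (wpow (bgen m xi n) p`_n) (wpow (wpow wb (tau m xi N n)) p`_n) by [].
by apply/wpow_weq/(BS_bgen HN); apply: leq_trans pk; exact: ltnW.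
Qed.

Lemma linB f g p : lin f p - lin g p = lin (fun i => f i - g i) p.
Proof. by rewrite /lin -sumrB; apply: eq_bigr => i _; rewrite mulrBr. Qed.

Lemma lin_dvd d f p : (forall i, (i < size p)%N -> (d %| f i)%Z) -> (d %| lin f p)%Z.
Proof. by move=> H; apply: rpred_sum => i _; apply/dvdz_mull/H. Qed.

Lemma coef0_lin p : p`_0 = lin (fun i => (i == 0%N)%:R) p.
Proof.
rewrite (lin_widen _ (leqnSn (size p))) big_ord_recl mulr1 big1 ?addr0 // => i _.
by rewrite mulr0.
Qed.

Lemma tau_rho m xi N k i : sexact m xi N k -> (i <= k)%N ->
  tau m xi N i - rho m xi i = m * (sint m xi N i - (i == 0%N)%:R).
Proof.
case: i => [|i] HN ik; first by rewrite !subrr mulr0.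
by rewrite [tau _ _ _ _]/= HN // addrK subr0.
Qed.

(** Hence [m] divides the exponent in BS(m, N) exactly when it divides the [rho] form. *)
Lemma lin_tau_rho m xi N k p : sexact m xi N k -> (size p <= k)%N ->
  lin (tau m xi N) p - lin (rho m xi) p = m * (lin (sint m xi N) p - p`_0).
Proof.
move=> HN pk; rewrite (coef0_lin p) !linB /lin mulr_sumr; apply: eq_bigr => i _.
by rewrite (tau_rho HN) 1?mulrCA // (leq_trans _ pk) // ltnW.
Qed.

Lemma lin_tau_theta m xi N k p : sexact m xi N k -> (size p <= k)%N ->
  lin (tau m xi N) (theta m xi p) = m * lin (sint m xi N) p.
Proof.
move=> HN pk; rewrite /theta linD linC mulr1.
rewrite -[lin (tau _ _ _) p](subrK (lin (rho m xi) p)) (lin_tau_rho HN pk); ring.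
Qed.

Lemma lin_tauX m xi N p : lin (tau m xi N) ('X * p) = N * lin (sint m xi N) p.
Proof.
rewrite linXM /lin mulr_sumr; apply: eq_bigr => i _; exact: mulrCA.
Qed.

Lemma dvd_lin_tau m xi N p : (N %| lin (tau m xi N) p - p`_0)%Z.
Proof.
rewrite coef0_lin linB; apply: lin_dvd => -[|i] _ /=; first by rewrite subrr.
by rewrite subr0; exact: dvdz_mulr.
Qed.

(** [theta q = 0] forces [q] to be constant, and [theta] multiplies constants by [m]. *)
Lemma theta_neq0 m xi q : m != 0 -> q != 0 -> theta m xi q != 0.
Proof.
move=> m0; apply: contraNneq => /eqP; rewrite addr_eq0 -polyCN => /eqP E.
have q0 : lin (rho m xi) q = q`_0 by rewrite E linC mulr1 coefC.
have Ec : q = (q`_0)%:P by rewrite E coefC.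
have := congr1 (fun p : {poly int} => p`_0) E; rewrite /= q0 coefC /= => H.
have /eqP : m * q`_0 = 0.
  by rewrite (_ : m * q`_0 = q`_0 - - (m * q`_0 - q`_0)); [rewrite -H subrr | ring].
by rewrite mulf_eq0 (negbTE m0) /= => /eqP z; rewrite Ec z.
Qed.

Lemma ev_not_dvd xs (c : int) : tends_infty xs -> c != 0 ->
  ev (fun n => ~~ (xs n %| c)%Z).
Proof.
move=> Hxs c0; have [n0 H] := Hxs `|c|; exists n0 => n /H {}H.
apply/negP; rewrite dvdzE => /dvdn_leq; rewrite absz_gt0 => /(_ c0); lia.
Qed.

Lemma ev_neq0 xs : tends_infty xs -> ev (fun n => xs n != 0).
Proof. by case/(_ 0) => n0 H; exists n0 => n /H; rewrite normr_gt0. Qed.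

(** If [p_0 != 0], a large [N] does not divide the exponent. Otherwise [p = 'X * q], and [m] times
    the exponent is [N] times that of [theta q], a polynomial of smaller size. *)
Lemma ev_lin_tau m xi xs p : m != 0 -> madic_conv m xs xi -> tends_infty xs ->
  p != 0 -> ev (fun n => lin (tau m xi (xs n)) p != 0).
Proof.
move=> m0 Hxs Hinf; elim: {p}(size p) {-2}p (leqnn (size p)) => [|k IH] p pk p0.
  by move: pk p0; rewrite leqn0 size_poly_eq0 => ->.
have [p00|p00] := eqVneq p`_0 0; last first.
  apply: ev_mono (ev_not_dvd Hinf p00) => n; apply: contra => /eqP E.
  by have := dvd_lin_tau m xi (xs n) p; rewrite E sub0r rpredN.
have [q Eq] := dvdXP p00.
have q0 : q != 0 by apply: contraNneq p0 => E; rewrite Eq E mulr0.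
have Sp : size p = (size q).+1 by rewrite Eq mulrC size_mulX.
have Sq : (0 < size q)%N by rewrite size_poly_gt0.
have qk : (size q <= k)%N by rewrite -ltnS -Sp.
have St : (size (theta m xi q) <= k)%N.
  apply: leq_trans (size_polyD _ _) _; rewrite geq_max qk /=.
  by apply: leq_trans (size_polyC_leq1 _) _; exact: leq_trans Sq qk.
have {}IH := IH _ St (theta_neq0 xi m0 q0).
apply: ev_mono (ev_and (ev_neq0 Hinf) (ev_and (ev_sexact (size q) m0 Hxs) IH)) => n [Hn [Hs]].
by rewrite Eq lin_tauX (lin_tau_theta Hs) // !mulf_eq0 (negbTE Hn) (negbTE m0).
Qed.

Lemma zpinch_ev m xi xs e p : m != 0 -> madic_conv m xs xi -> tends_infty xs ->
  ~~ ppinch m xi e p -> ev (fun n => ~~ zpinch m (xs n) e (lin (tau m xi (xs n)) p)).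
Proof.
move=> m0 Hxs Hinf; case: e => /= Hp.
  apply: ev_mono (ev_not_dvd Hinf Hp) => n; apply: contra; rewrite /zpinch /= => H.
  by have := dvd_lin_tau m xi (xs n) p; rewrite (rpredBl _ H).
apply: ev_mono (ev_sexact (size p) m0 Hxs) => n Hn; apply: contra Hp.
rewrite /zpinch /= => H; have := lin_tau_rho Hn (leqnn _).
move/eqP; rewrite subr_eq addrC -subr_eq => /eqP <-.
by rewrite rpredB // dvdz_mulr.
Qed.

Definition zform m xi N (s : seq (bool * {poly int})) : seq (bool * int) :=
  [seq (x.1, lin (tau m xi N) x.2) | x <- s].

Lemma ev_reduced m xi xs s : m != 0 -> madic_conv m xs xi -> tends_infty xs ->
  reduced (ppinch m xi) s ->
  ev (fun n => reduced (zpinch m (xs n)) (zform m xi (xs n) s)).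
Proof.
move=> m0 Hxs Hinf; elim: s => [|[e p] s IH]; first by move=> _; apply: ev_true.
case=> Hp /IH {}IH; case: s Hp IH => [|[e' p'] s] Hp IH.
  by apply: ev_true => n; split=> //; move=> ? ? ? [].
have [E|E] := eqVneq e' (~~ e).
  have /negP/(zpinch_ev m0 Hxs Hinf) H := Hp _ _ _ erefl E.
  by apply: ev_mono (ev_and H IH) => n [/negP Hn Hs]; split.
by apply: ev_mono IH => n Hs; split=> // ? ? ? [<- _ _] E'; rewrite E' eqxx in E.
Qed.

Lemma ev_sform m xi xs p s : m != 0 -> madic_conv m xs xi ->
  ev (fun n => weq (BS_rel m (xs n)) (sform (vw m xi) p s)
     (sform (wpow wb) (lin (tau m xi (xs n)) p) (zform m xi (xs n) s))).
Proof.
move=> m0 Hxs; elim: s p => [|[e p'] s IH] p.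
  apply: ev_mono (ev_sexact (size p) m0 Hxs) => n Hn /=.
  by rewrite (BS_vw Hn).
apply: ev_mono (ev_and (ev_sexact (size p) m0 Hxs) (IH p')) => n [Hn Hs].
apply: weq_cat (BS_vw Hn (leqnn _)) _.
exact: (weq_cat (weq_refl _ [:: (Ga, e)]) Hs).
Qed.

(** Either the symbolic form of [w] is trivial, or its image in BS(m, N) is eventually reduced and
    nontrivial. *)
Lemma limit_dichotomy m xi xs w : m != 0 -> madic_conv m xs xi -> tends_infty xs ->
  nclos (BSbar_rel m xi) w \/ ev (fun n => ~ BS m (xs n) w).
Proof.
move=> m0 Hxs Hinf; have [p [s [Hs Hw]]] := symbolic_form m xi w.
have [[E1 E2]|Hne] : (s = [::] /\ p = 0) \/ (s = [::] -> p != 0).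
  case: s {Hs Hw} => [|x s]; last by right.
  by have [->|p0] := eqVneq p 0; [left|right].
  by left; apply/weq_nil; rewrite Hw E1 E2 /= vw0.
right.
have Hp : ev (fun n => zform m xi (xs n) s = [::] -> lin (tau m xi (xs n)) p != 0).
  case: s {Hs Hw} Hne => [|x s] Hne; last exact: ev_true.
  by apply: ev_mono (ev_lin_tau m0 Hxs Hinf (Hne erefl)) => n.
have := ev_and (ev_and (ev_neq0 Hinf) Hp) (ev_and (ev_reduced m0 Hxs Hinf Hs)
   (ev_and (ev_BS m0 Hxs Hw) (ev_sform p s m0 Hxs))).
apply: ev_mono => n [[Hn Hpn] [Hsn [Hwn Hfn]]] HBS.
apply: (britton m0 Hn Hsn Hpn); apply/weq_nil.
have E : weq (BS_rel m (xs n)) w (sform (vw m xi) p s) := Hwn.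
by rewrite -Hfn -E; apply/weq_nil.
Qed.

Lemma BSbar_limit m xi xs : m != 0 -> madic_conv m xs xi -> tends_infty xs ->
  mconv (fun n => BS m (xs n)) (nclos (BSbar_rel m xi)).
Proof.
move=> m0 Hxs Hinf L.
apply: (ev_words (P := fun w n => BS m (xs n) w <-> nclos (BSbar_rel m xi) w)) => w.
have [H|H] := limit_dichotomy w m0 Hxs Hinf.
  by apply: ev_mono (ev_BS m0 Hxs H) => n Hn; split.
apply: ev_mono (H) => n Hn; split=> [//|/(ev_BS m0 Hxs) Hw].
by case: (ev_absurd Hw H).
Qed.

Lemma bw_zero m i : (1 <= i)%N ->
  bw m (fun _ => 0) i = wpown wa i ++ wpow wb m ++ winv (wpown wa i).
Proof.
have r0 j : r_ m (fun _ => 0) j = 0 by case: j => [|j] //; rewrite /r_ /= mul0r mod0z.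
elim: i => [//|[|i] IH] _ //.
have -> : bw m (fun _ => 0) i.+2 =
  wa ++ bw m (fun _ => 0) i.+1 ++ wpow wb (- r_ m (fun _ => 0) i.+1) ++ winv wa by [].
rewrite IH // r0 oppr0.
have -> : wpown wa i.+2 = wa ++ wpown wa i.+1 by [].
by rewrite winv_cat -!catA.
Qed.

End Limit.

Unset Implicit Arguments.

Theorem theorem3p1 :
  forall m : int, m != 0 ->
  (forall xi : nat -> int, is_madic m xi ->
     forall xs : nat -> int, tends_infty xs -> madic_conv m xs xi ->
       mconv (fun n => BS m (xs n)) (nclos (BSbar_rel m xi)))
  /\
  (forall xs : nat -> int, tends_infty xs -> madic_conv m xs (fun _ => 0) ->
       mconv (fun n => BS m (xs n)) (nclos (BS0_rel_except m 0)))
  /\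
  (forall k : nat, (1 <= k)%N ->
     ~ nclos (BS0_rel_except m k)
         (wcomm wb (wpown wa k ++ wpow wb m ++ winv (wpown wa k)))).
Proof.
move=> m m0; split; [|split].
- by move=> xi _ xs Hinf Hxs; exact: BSbar_limit.
- move=> xs Hinf Hxs L; have [n0 H] := BSbar_limit m0 Hxs Hinf L.
  exists n0 => n Hn w Hw; rewrite (H n Hn w Hw); split; apply: nclos_sub => r.
    (* With [k = 0] the clause [i != k] follows from [1 <= i]. *)
    by case=> i [i1 ->]; apply: nclos_rel; exists i; rewrite bw_zero // -lt0n.
  by case=> i [i1 _ ->]; apply: nclos_rel; exists i; rewrite bw_zero.
- move=> k; exact: BS0_minimal.
Qed.
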